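(* Consider the system $$\dot x_i = -\delta_i x_i + \pi\sum_{j=1}^n a^{(2)}_{ij}\psi_j(x_j) + \pi\sum_{j,k=1}^n a^{(3)}_{ijk}\psi_j(x_j)\psi_k(x_k),\qquad i=1,\dots,n,$$ and suppose that the functions $\psi_i$ satisfy (A.1)--(A.5) and that the matrices $A^{(3)}_i$ satisfy (i)--(iii) for all $i$ (conditions listed in the context). Let $g:\mathbb{R}_+\times\mathbb{R}_+\to\mathbb{R}$ be $$g(\varepsilon,\pi):=-(1+\alpha)\varepsilon+\pi\big(\psi_u(\varepsilon)+\alpha\,\psi_u(\varepsilon)^2\big),$$ and let $\pi_1^\ast$ be the value solving $$g(\varepsilon,\pi_1^\ast)=0,\qquad \frac{\partial g}{\partial\varepsilon}(\varepsilon,\pi_1^\ast)=0,\qquad \varepsilon>0.$$ Then, for each $\pi>\pi_1^\ast$, the system admits two consensus equilibrium points $\varepsilon_1\mathbb{1}_n$ and $\varepsilon_2\mathbb{1}_n$, where $\varepsilon_1,\varepsilon_2$ are the two solutions of $g(\varepsilon,\pi)=0$.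
   Context: Setting. $n\ge 2$ agents with opinions $x=(x_1,\dots,x_n)\in\mathbb{R}^n$; $\pi>0$ is a scalar parameter; $\mathbb{1}_n\in\mathbb{R}^n$ is the all-ones vector. A consensus equilibrium is an equilibrium point lying in $\mathrm{span}(\mathbb{1}_n)$. $A^{(2)}=[a^{(2)}_{ij}]\in\mathbb{R}^{n\times n}$ is entrywise nonnegative, symmetric, irreducible, with zero diagonal. $A^{(3)}=(a^{(3)}_{ijk})$ is an entrywise nonnegative $n\times n\times n$ tensor; for each $i$, $A^{(3)}_i:=[a^{(3)}_{ijk}]_{j,k=1}^n\in\mathbb{R}^{n\times n}$. The degrees are $\delta_i=\sum_j a^{(2)}_{ij}+\sum_{j,k}a^{(3)}_{ijk}>0$. Conditions on the differentiable functions $\psi_i:\mathbb{R}\to\mathbb{R}$: (A.1) $\psi_i(-s)=-\psi_i(s)$ for all $s$; (A.2) $\psi_i'(s)>0$ for all $s$ and $\psi_i'(0)=1$; (A.3) $\lim_{s\to\pm\infty}\psi_i(s)=\pm1$; (A.4) $\psi_i$ is strictly convex for $s<0$ and strictly concave for $s>0$; (A.5) all $\psi_i$ are equal to one function, denoted $\psi_u$. Conditions on $A^{(3)}_i$: (i) $A^{(3)}_i=(A^{(3)}_i)^T$; (ii) $[A^{(3)}_i]_{ij}=[A^{(3)}_i]_{ji}=0$ for all $j$; (iii) there is a scalar $\alpha$, independent of $i$, with $\sum_{j,k}[A^{(3)}_i]_{jk}=\alpha\sum_j a^{(2)}_{ij}$, i.e. $\mathbb{1}_n^TA^{(3)}_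i\mathbb{1}_n=\alpha[A^{(2)}\mathbb{1}_n]_i$.
   Formalization: g is extended to all real ε: for π ≥ 1+α only one positive solution need exist, so ε_1 may be negative (or 0 at π = 1+α); the solution ε = 0 is set apart, and that ε_1, ε_2 are the only others is stated when π_1^* is the only tangency value. *)

(* Defs.v *)
From HB Require Import structures.
From mathcomp Require Import all_boot all_order all_algebra.
From mathcomp Require Import fingroup perm.
From mathcomp Require Import all_classical all_reals all_analysis.
Set Implicit Arguments.
Unset Strict Implicit.
Unset Printing Implicit Defensive.
Import Order.TTheory GRing.Theory Num.Theory.
Import numFieldNormedType.Exports.
Local Open Scope classical_set_scope.
Local Open Scope ring_scope.

Definition strictly_convex_on (R : realType) (D : set R) (f : R -> R) : Prop :=
  forall (x y t : R), D x -> D y -> x != y -> 0 < t < 1 ->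
    f (t * x + (1 - t) * y) < t * f x + (1 - t) * f y.

Definition strictly_concave_on (R : realType) (D : set R) (f : R -> R) : Prop :=
  strictly_convex_on D (fun x => - f x).

Definition sigmoidal (R : realType) (f : R -> R) : Prop :=
  [/\ forall s, derivable f s 1,
      forall s, f (- s) = - f s,
      (forall s, 0 < derive1 f s) /\ derive1 f 0 = 1,
      (f s @[s --> +oo] --> (1 : R)) /\ (f s @[s --> -oo] --> (-1 : R))
    & strictly_convex_on [set s | s < 0] f /\
      strictly_concave_on [set s | 0 < s] f].

(* A simultaneous permutation of rows and columns brings A to the block form
   [* *; 0 *], where both diagonal blocks are nonempty. *)
Definition reducible_mx (R : realType) (n : nat) (A : 'M[R]_n) : Prop :=
  exists (s : 'S_n) (r : nat), (0 < r < n)%N /\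
    forall i j : 'I_n, (r <= i)%N -> (j < r)%N ->
      row_perm s (col_perm s A) i j = 0.

Definition irreducible_mx (R : realType) (n : nat) (A : 'M[R]_n) : Prop :=
  ~ reducible_mx A.

(* A third-order tensor is the family of its slices: a_ijk is A3 i j k. *)
Definition degree (R : realType) (n : nat) (A2 : 'M[R]_n)
    (A3 : 'I_n -> 'M[R]_n) (i : 'I_n) : R :=
  \sum_j A2 i j + \sum_j \sum_k A3 i j k.

Definition opinion_field (R : realType) (n : nat) (A2 : 'M[R]_n)
    (A3 : 'I_n -> 'M[R]_n) (psi : 'I_n -> R -> R) (p : R)
    (x : 'cV[R]_n) : 'cV[R]_n :=
  \col_i (- degree A2 A3 i * x i 0
          + p * (\sum_j A2 i j * psi j (x j 0))
          + p * (\sum_j \sum_k A3 i j k * psi j (x j 0) * psi k (x k 0))).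

Definition ones (R : realType) (n : nat) : 'cV[R]_n := const_mx 1.

Definition consensus_equilibrium (R : realType) (n : nat)
    (F : 'cV[R]_n -> 'cV[R]_n) (x : 'cV[R]_n) : Prop :=
  F x = 0 /\ x \in <[ones R n]>%VS.

(* The formula is taken on the whole line, so that negative consensus values
   are covered as well; tangency_value restricts both arguments to be
   positive. *)
Definition gfun (R : realType) (alpha : R) (psiu : R -> R) (e p : R) : R :=
  - (1 + alpha) * e + p * (psiu e + alpha * psiu e ^+ 2).

Definition tangency_value (R : realType) (alpha : R) (psiu : R -> R)
    (p : R) : Prop :=
  0 < p /\ exists e : R,
    [/\ 0 < e, gfun alpha psiu e p = 0
      & derive1 (fun t => gfun alpha psiu t p) e = 0].

(* Main.v *)
(* On the line spanned by ones, the i-th component of the field is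
   (\sum_j A2 i j) * g(e, p), so consensus equilibria are the zeros of g(., p).
   Write f = psiu + alpha psiu^2.  A zero x > 0 satisfies
   f x / x = (1 + alpha) / p, and the critical points of f x / x on x > 0 are
   exactly the tangencies.  At the tangency point es of p1, g(es, p) > 0 for
   p > p1, and g(., p) is negative far to the right, which gives e2 > es.  The
   other zero lies in (0, es) if p < 1 + alpha, where g(., p) has negative slope
   at 0, and on the negative axis if p > 1 + alpha; at p = 1 + alpha it merges
   with 0.  If p1 is the only tangency value, a further positive zero would
   create a local minimum of f x / x, hence a tangency at a parameter at least
   p.  On the negative axis uniqueness comes from the concavity of psiu. *)
Require Import Defs.
From HB Require Import structures.
From mathcomp Require Import all_boot all_order all_algebra.
From mathcomp Require Import all_classical all_reals all_analysis.
From mathcomp Require Import ring lra.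
Import Order.TTheory GRing.Theory Num.Theory.
Import numFieldNormedType.Exports.
Local Open Scope classical_set_scope.
Local Open Scope ring_scope.

Set Implicit Arguments.
Unset Strict Implicit.
Unset Printing Implicit Defensive.

(** * Secants at the origin and properties of sigmoidal functions *)

Lemma secant_near0 (R : realType) (f : R -> R) (l k d : R) :
  is_derive (0 : R) (1 : R) f l -> f 0 = 0 -> k < l -> 0 < d ->
  exists r : R, [/\ 0 < r < d, k * r < f r & f (- r) < - (k * r)].
Proof.
move=> [df Df] f0 kl d0.
have : \forall h \near (0 : R)^', k < h^-1 *: (f (h *: (1 : R) + 0) - f 0).
  have Hl : h^-1 *: (f (h *: (1 : R) + 0) - f 0) @[h --> (0 : R)^'] --> l.
    by rewrite -Df; exact: df.
  exact: (cvgr_gt _ Hl _ kl).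
rewrite near_withinE => -[e /= e0 He].
have Hk (h : R) : `|h| < e -> h != 0 -> k < h^-1 * f h.
  move=> he h0; have := He h; rewrite /= sub0r normrN => /(_ he h0).
  by rewrite f0 subr0 addr0 /GRing.scale /= mulr1.
set m := Num.min e d; have m0 : 0 < m by rewrite lt_min e0.
have [me md] : m <= e /\ m <= d by rewrite !ge_min !lexx orbT.
have r0 : 0 < m / 2 by lra.
exists (m / 2); split; first by apply/andP; split; lra.
- have := Hk (m / 2); rewrite gtr0_norm// gt_eqF// => /(_ _ isT) H.
  by rewrite -ltr_pdivlMr// mulrC H//; lra.
- have := Hk (- (m / 2)); rewrite normrN gtr0_norm// oppr_eq0 gt_eqF//.
  move=> /(_ _ isT) H.
  have {H} : k < (- (m / 2))^-1 * f (- (m / 2)) by apply: H; lra.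
  by rewrite invrN mulNr -mulrN mulrC ltr_pdivlMr// => H; rewrite -ltrN2 opprK.
Qed.

Lemma sigmoidal0 (R : realType) (psi : R -> R) : sigmoidal psi -> psi 0 = 0.
Proof. by case=> _ /(_ 0) + _ _ _; rewrite oppr0 => h; lra. Qed.

Lemma sigmoidal_is_derive0 (R : realType) (psi : R -> R) :
  sigmoidal psi -> is_derive (0 : R) (1 : R) psi 1.
Proof. by case=> d _ [_ d1] _ _; apply: DeriveDef => //; rewrite -derive1E. Qed.

Lemma sigmoidal_continuous (R : realType) (psi : R -> R) :
  sigmoidal psi -> continuous psi.
Proof.
by case=> d _ _ _ _ x; apply/differentiable_continuous/derivable1_diffP/d.
Qed.

Lemma sigmoidal_incr (R : realType) (psi : R -> R) :
  sigmoidal psi -> {homo psi : x y / x < y}.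
Proof.
move=> sig x y xy; have [d _ [dgt0 _] _ _] := sig.
apply: (@gtr0_derive1_lt_cc R psi x y); rewrite ?in_itv/= ?lexx ?(ltW xy)//.
exact/continuous_subspaceT/sigmoidal_continuous.
Qed.

Lemma sigmoidal_gt0 (R : realType) (psi : R -> R) (s : R) :
  sigmoidal psi -> 0 < s -> 0 < psi s.
Proof. by move=> sig s0; rewrite -(sigmoidal0 sig); exact: sigmoidal_incr. Qed.

(** Strict concavity and [psi 0 = 0] make [psi s / s] strictly decreasing. Concavity is given only
    on the open half-line, so the endpoint 0 is reached by continuity. *)
Lemma sigmoidal_chord (R : realType) (psi : R -> R) (s t : R) :
  sigmoidal psi -> 0 < s < t -> s * psi t < t * psi s.
Proof.
move=> sig /andP[s0 st]; have [_ _ _ _ [_ conc]] := sig.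
have slopes (x y z : R) : 0 < x -> x < y -> y < z ->
    (y - x) * (psi z - psi y) < (z - y) * (psi y - psi x).
  move=> x0 xy yz; have zx : 0 < z - x by lra.
  have zxu : z - x != 0 by rewrite gt_eqF.
  have := conc x z ((z - y) / (z - x)); rewrite /= => /(_ x0).
  have -> : 1 - (z - y) / (z - x) = (y - x) / (z - x) by field.
  have -> : (z - y) / (z - x) * x + (y - x) / (z - x) * z = y by field.
  move=> H.
  have {}H : (z - y) / (z - x) * psi x + (y - x) / (z - x) * psi z < psi y.
    rewrite -ltrN2 opprD -!mulrN; apply: H; [lra|by rewrite lt_eqF//; lra|].
    by apply/andP; split; [apply: divr_gt0|rewrite ltr_pdivrMr// mul1r]; lra.
  move: H; rewrite -(ltr_pM2l zx).
  have -> : (z - x) * ((z - y) / (z - x) * psi x + (y - x) / (z - x) * psi z)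
     = (z - y) * psi x + (y - x) * psi z by field.
  by lra.
(* The slopes on [0, u], [u, s] and [s, t] are compared; the midpoint makes the first two intervals
   equally long. *)
set u := s / 2; have u0 : 0 < u by rewrite /u; lra.
have us : u < s by rewrite /u; lra.
(* The slope on [0, u] is the limit of the slopes on [x, u] as x tends to 0. *)
have slope0 : u * (psi s - psi u) <= (s - u) * psi u.
  rewrite leNgt; apply/negP => neg.
  pose G (x : R) := (u - x) * (psi s - psi u) - (s - u) * (psi u - psi x).
  have cG : continuous G.
    move=> x; apply: cvgB.
      by apply: cvgM; [apply: cvgB; [exact: cvg_cst|exact: cvg_id]|exact: cvg_cst].
    apply: cvgM; first exact: cvg_cst.
    by apply: cvgB; [exact: cvg_cst|exact: sigmoidal_continuous].
  have G0 : 0 < G 0 by rewrite /G (sigmoidal0 sig); lra.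
  have : \forall x \near (0 : R), 0 < G x by exact: (cvgr_gt _ (cG 0) _ G0).
  move=> -[e /= e0 He].
  set m := Num.min e u; have m0 : 0 < m by rewrite lt_min e0.
  have [me mu] : m <= e /\ m <= u by rewrite !ge_min !lexx orbT.
  have := He (m / 2); rewrite /ball_/= sub0r normrN gtr0_norm; last lra.
  have := slopes (m / 2) u s; rewrite /G => H1 H2.
  have : (u - m / 2) * (psi s - psi u) < (s - u) * (psi u - psi (m / 2)).
    by apply: H1; lra.
  by have := H2 ltac:(lra); lra.
have {}slope0 : psi s - psi u <= psi u.
  by rewrite -(ler_pM2l u0); apply: le_trans slope0 _; rewrite /u; lra.
have := slopes u s t u0 us st; rewrite /u in slope0 *.
have : (t - s) * (psi s - psi (s / 2)) <= (t - s) * (psi s / 2).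
  by rewrite ler_pM2l; lra.
by lra.
Qed.

(** The ratio [psi s / s] strictly decreases from its limit [psi' 0 = 1]. If it were at least 1 at
    [t], it would exceed 1 at [t / 2] and stay above that value down to 0. *)
Lemma sigmoidal_lt_id (R : realType) (psi : R -> R) (t : R) :
  sigmoidal psi -> 0 < t -> psi t < t.
Proof.
move=> sig t0; rewrite ltNge; apply/negP => tpsi.
have h0 : 0 < t / 2 by lra.
have := sigmoidal_chord (psi := psi) (s := t / 2) (t := t) sig ltac:(lra).
move=> chord; have m1 : 1 < psi (t / 2) / (t / 2).
  by rewrite ltr_pdivlMr// mul1r; nra.
(* [secant_near0] bounds secants from below; passing to [- psi] gives the upper bound needed
   here. *)
have dN : is_derive (0 : R) (1 : R) (- psi) (- 1).
  by apply: is_deriveN; exact: sigmoidal_is_derive0.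
have [r [/andP[r0 rt] + _]] := secant_near0
  (k := - (psi (t / 2) / (t / 2))) dN
  ltac:(by rewrite /= fctE (sigmoidal0 sig) oppr0) ltac:(lra) h0.
rewrite fctE => Hr.
have := sigmoidal_chord (psi := psi) (s := r) (t := t / 2) sig ltac:(lra).
move: Hr; rewrite mulNr ltrN2 mulrAC ltr_pdivlMr// => Hr H.
by lra.
Qed.

(** * The response function, its ratio to the identity, and tangencies *)

Definition response (R : realType) (alpha : R) (psi : R -> R) (e : R) : R :=
  psi e + alpha * psi e ^+ 2.

Lemma is_derive_response (R : realType) (alpha : R) (psi : R -> R) (x l : R) :
  is_derive x (1 : R) psi l ->
  is_derive x (1 : R) (response alpha psi) (l + alpha * (2 * psi x * l)).
Proof.
move=> dl.
have := is_deriveD dl (is_deriveZ alpha (is_deriveX 2 dl)).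
by rewrite /= expr1.
Qed.

Lemma is_derive_gfun (R : realType) (alpha : R) (psi : R -> R) (p x l : R) :
  is_derive x (1 : R) (response alpha psi) l ->
  is_derive x (1 : R) (fun t => gfun alpha psi t p) (- (1 + alpha) + p * l).
Proof.
move=> dl.
have := is_deriveD (is_deriveZ (- (1 + alpha)) (is_derive_id x (1 : R)))
  (is_deriveZ p dl).
by rewrite {1}/GRing.scale/= mulr1.
Qed.

Lemma derivable_gfun (R : realType) (alpha : R) (psi : R -> R) (p x : R) :
  sigmoidal psi -> derivable (fun t => gfun alpha psi t p) x 1.
Proof.
case=> d _ _ _ _.
by have [] := is_derive_gfun p (is_derive_response alpha (derivableP (d x))).
Qed.

Lemma continuous_gfun (R : realType) (alpha : R) (psi : R -> R) (p : R) :
  sigmoidal psi -> continuous (fun t => gfun alpha psi t p).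
Proof.
move=> sig x.
exact/differentiable_continuous/derivable1_diffP/derivable_gfun.
Qed.

Lemma response_gt0 (R : realType) (alpha : R) (psi : R -> R) (x : R) :
  0 <= alpha -> sigmoidal psi -> 0 < x -> 0 < response alpha psi x.
Proof.
move=> a0 sig x0; rewrite /response ltr_pwDl ?sigmoidal_gt0//.
by rewrite mulr_ge0// sqr_ge0.
Qed.

Lemma gfun_ratio (R : realType) (alpha : R) (psi : R -> R) (x p : R) :
  p != 0 -> x != 0 ->
  gfun alpha psi x p = p * x * (response alpha psi x / x - (1 + alpha) / p).
Proof.
by move=> p0 x0; rewrite /gfun -/(response alpha psi x); field; rewrite p0 x0.
Qed.

(* A local minimum c of [response x / x] is a critical point with
   [response' c = response c / c], so it is a tangency at parameter
   [(1 + alpha) / (response c / c)]. *)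
Lemma valley_tangency (R : realType) (alpha : R) (psi : R -> R) (a b d : R) :
  0 <= alpha -> sigmoidal psi -> 0 < a -> a < b < d ->
  response alpha psi b / b <= response alpha psi a / a ->
  response alpha psi b / b <= response alpha psi d / d ->
  exists2 q, tangency_value alpha psi q & 0 <= gfun alpha psi b q.
Proof.
move=> al0 sig a0 /andP[ab bd] ba bd'.
set phi := fun x => response alpha psi x / x.
have b0 : 0 < b by lra.
have ad : a <= d by lra.
have cphi : {within `[a, d], continuous phi}.
  apply: derivable_within_continuous => x; rewrite in_itv/= => /andP[ax xd].
  have x0 : x != 0 by rewrite gt_eqF//; lra.
  apply: derivableM; last exact: derivableV.
  have [dpsi _ _ _ _] := sig.
  by apply: ex_derive; exact/is_derive_response/derivableP/dpsi.
have [m mad mmin] := EVT_min ad cphi.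
(* Fermat's theorem needs an interior minimum. If the minimum found lies at an endpoint, [b] attains
   it too, since the ratio at [b] is at most its value at either end. *)
have [c [cad cmin]] :
    exists c, a < c < d /\ forall t, t \in `[a, d] -> phi c <= phi t.
  move: (mad); rewrite in_itv/= => /andP[am md].
  have [/andP H|] := boolP ((a < m) && (m < d)); first by exists m; split; [exact/andP|].
  rewrite negb_and -!leNgt => H; exists b; split; first exact/andP.
  move=> t /mmin; apply: le_trans.
  have [ma|dm] := orP H.
    by have -> : m = a by lra.
  by have -> : m = d by lra.
have /andP[ac cd] := cad.
have c0 : 0 < c by lra.
have phic0 : 0 < phi c by rewrite divr_gt0// response_gt0.
set q := (1 + alpha) / phi c.
have q0 : 0 < q by rewrite divr_gt0//; lra.
have qphi : (1 + alpha) / q = phi c.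
  by rewrite /q; field; rewrite gt_eqF// gt_eqF//; lra.
(* This factorisation makes [c] a minimum, with value 0, of g(., q) as well, so no derivative of the
   quotient [phi] is needed. *)
have gq x : 0 < x -> gfun alpha psi x q = q * x * (phi x - phi c).
  by move=> x0; rewrite gfun_ratio ?gt_eqF// qphi.
have gc : gfun alpha psi c q = 0 by rewrite gq// subrr mulr0.
have gq0 t : a <= t <= d -> 0 <= gfun alpha psi t q.
  move=> atd; have t0 : 0 < t by lra.
  rewrite gq//; apply: mulr_ge0; first by rewrite mulr_ge0 ?ltW.
  by rewrite subr_ge0 cmin// in_itv.
exists q; last by apply: gq0; lra.
split => //; exists c; split => //.
rewrite derive1E; apply: derive_val.
apply: (@derive1_at_min _ (fun t => gfun alpha psi t q) a d c ad).
- by move=> t _; exact: derivable_gfun.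
- by rewrite in_itv.
- by move=> t; rewrite in_itv/= gc => /andP[at' td]; apply: gq0; lra.
Qed.

Lemma gfun_mono (R : realType) (alpha : R) (psi : R -> R) (x p q : R) :
  0 <= alpha -> sigmoidal psi -> 0 < x -> p < q ->
  gfun alpha psi x p < gfun alpha psi x q.
Proof.
by move=> al0 sig x0 pq; rewrite ltrD2l ltr_pM2r// response_gt0.
Qed.

(** A valley at [b] yields a tangency, necessarily at [p1], with g(b, p1) >= 0; strict growth of g
    in its parameter then contradicts g(b, p) <= 0. *)
Lemma no_valley (R : realType) (alpha : R) (psi : R -> R) (p1 p a b d : R) :
  0 <= alpha -> sigmoidal psi ->
  (forall q, tangency_value alpha psi q -> q = p1) -> p1 < p ->
  0 < a -> a < b < d -> gfun alpha psi b p <= 0 ->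
  response alpha psi b / b <= response alpha psi a / a ->
  ~ response alpha psi b / b <= response alpha psi d / d.
Proof.
move=> al0 sig uniq p1p a0 abd gb ba bd.
have [q /uniq ->] := valley_tangency al0 sig a0 abd ba bd.
have b0 : 0 < b by lra.
by have := gfun_mono al0 sig b0 p1p; lra.
Qed.

(** * Zeros far from the origin and on the negative axis *)

Lemma gfun_pos_zero_after (R : realType) (alpha : R) (psi : R -> R) (p e : R) :
  0 <= alpha -> sigmoidal psi -> 0 < p -> 0 < gfun alpha psi e p ->
  exists2 e2, e < e2 & gfun alpha psi e2 p = 0.
Proof.
move=> al0 sig p0 ge; have [_ _ _ [lim1 _] _] := sig.
(* Once [psi y < 2], a bound above the limit 1, [p * response y] stays below [M], and the linear
   term wins for [y > M]. *)
pose M := p * (2 + alpha * 4).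
have [y [ey My y0 psiy]] : exists y, [/\ e < y, M < y, 0 < y & psi y < 2].
  near (+oo : set_system R) => y; exists y; split; near: y.
  - by apply: nbhs_pinfty_gt; exact: num_real.
  - by apply: nbhs_pinfty_gt; exact: num_real.
  - by apply: nbhs_pinfty_gt; exact: num_real.
  - by apply: (cvgr_lt _ lim1); lra.
have gy : gfun alpha psi y p < 0.
  have psi0 := sigmoidal_gt0 sig y0.
  have : response alpha psi y < 2 + alpha * 4.
    by apply: ltr_leD => //; rewrite ler_wpM2l//; nra.
  rewrite -(ltr_pM2l p0) -/M /gfun -/(response alpha psi y) => H.
  by have := mulr_ge0 al0 (ltW y0); lra.
have [|c] := IVT (v := 0) (ltW ey)
  (continuous_subspaceT (@continuous_gfun R alpha psi p sig)).
  by apply/andP; split; rewrite ?ge_min ?le_max ?(ltW gy) ?(ltW ge) ?orbT.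
rewrite in_itv/= => /andP[ec _] gc; exists c => //.
by rewrite lt_neqAle ec andbT; apply/eqP => E; move: ge; rewrite E gc ltxx.
Unshelve. all: by end_near. Qed.

Lemma gfun_neg_zero_before (R : realType) (alpha : R) (psi : R -> R) (p e : R) :
  0 <= alpha -> sigmoidal psi -> 0 < p -> gfun alpha psi e p < 0 ->
  exists2 e1, e1 < e & gfun alpha psi e1 p = 0.
Proof.
move=> al0 sig p0 ge; have [_ _ _ [_ lim1] _] := sig.
(* The square term of the response only raises g, so the threshold [- (2 * p)] does not involve
   [alpha]. *)
have [y [ey My y0 psiy]] :
    exists y, [/\ y < e, y < - (2 * p), y < 0 & - 2 < psi y].
  near (-oo : set_system R) => y; exists y; split; near: y.
  - by apply: nbhs_ninfty_lt; exact: num_real.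
  - by apply: nbhs_ninfty_lt; exact: num_real.
  - by apply: nbhs_ninfty_lt; exact: num_real.
  - by apply: (cvgr_gt _ lim1); lra.
have gy : 0 < gfun alpha psi y p.
  have : - 2 < response alpha psi y.
    by apply: ltr_wpDr => //; rewrite mulr_ge0// sqr_ge0.
  rewrite -(ltr_pM2l p0) /gfun -/(response alpha psi y) => H.
  have : 0 <= alpha * - y by rewrite mulr_ge0//; lra.
  by lra.
have [|c] := IVT (v := 0) (ltW ey)
  (continuous_subspaceT (@continuous_gfun R alpha psi p sig)).
  by apply/andP; split; rewrite ?ge_min ?le_max ?(ltW gy) ?(ltW ge) ?orbT.
rewrite in_itv/= => /andP[_ ce] gc; exists c => //.
by rewrite lt_neqAle ce andbT; apply/eqP => E; move: ge; rewrite -E gc ltxx.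
Unshelve. all: by end_near. Qed.

Lemma gfunN (R : realType) (alpha : R) (psi : R -> R) (t p : R) :
  sigmoidal psi ->
  gfun alpha psi (- t) p = (1 + alpha) * t - p * psi t * (1 - alpha * psi t).
Proof. by case=> _ odd _ _ _; rewrite /gfun odd; ring. Qed.

(* For x = - t < 0 the equation is
   [(1 + alpha) / p = psi t / t * (1 - alpha * psi t)],
   whose right side is decreasing in t where it is positive. *)
Lemma gfun_neg_zero_uniq (R : realType) (alpha : R) (psi : R -> R) (p s t : R) :
  0 <= alpha -> sigmoidal psi -> 0 < p -> 0 < s < t ->
  gfun alpha psi (- s) p = 0 -> gfun alpha psi (- t) p != 0.
Proof.
move=> al0 sig p0 /andP[s0 st] /eqP; rewrite !gfunN// subr_eq0 => /eqP gs.
apply/negP; rewrite subr_eq0 => /eqP gt.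
have t0 : 0 < t by lra.
have ps0 := sigmoidal_gt0 sig s0; have pt0 := sigmoidal_gt0 sig t0.
have pst : psi s < psi t by exact: sigmoidal_incr.
(* Positivity of this factor comes from the equation at [t], whose left side is positive. *)
have ut : 0 < 1 - alpha * psi t.
  by rewrite -(pmulr_rgt0 _ (mulr_gt0 p0 pt0)) -gt mulr_gt0//; lra.
have ust : 1 - alpha * psi t <= 1 - alpha * psi s.
  by rewrite lerD2l lerN2 ler_wpM2l// ltW.
have chord : s * psi t < t * psi s by apply: sigmoidal_chord => //; apply/andP.
have H1 : s * psi t * (1 - alpha * psi t) < t * psi s * (1 - alpha * psi s).
  apply: (@lt_le_trans _ _ (t * psi s * (1 - alpha * psi t))).
    by rewrite ltr_pM2r.
  by rewrite ler_pM2l// mulr_gt0.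
(* After multiplication by [p], the two equations turn both sides into [(1 + alpha) * s * t]. *)
move: H1; rewrite -(ltr_pM2l p0).
have -> : p * (s * psi t * (1 - alpha * psi t)) = s * ((1 + alpha) * t).
  by rewrite gt; ring.
have -> : p * (t * psi s * (1 - alpha * psi s)) = t * ((1 + alpha) * s).
  by rewrite gs; ring.
by lra.
Qed.

(** Here [p * psi t < p * t <= (1 + alpha) * t], and the quadratic term is nonnegative. *)
Lemma gfun_neg_no_zero (R : realType) (alpha : R) (psi : R -> R) (p t : R) :
  0 <= alpha -> sigmoidal psi -> 0 < p <= 1 + alpha -> 0 < t ->
  0 < gfun alpha psi (- t) p.
Proof.
move=> al0 sig /andP[p0 pa] t0; rewrite gfunN//.
have lt_id := sigmoidal_lt_id sig t0; have pt0 := sigmoidal_gt0 sig t0.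
have : 0 <= p * (alpha * (psi t * psi t)) by rewrite !mulr_ge0// ltW.
have : p * psi t < p * t by rewrite ltr_pM2l.
have : p * t <= (1 + alpha) * t by rewrite ler_pM2r.
by lra.
Qed.

(** * Behaviour at the origin and uniqueness of positive zeros *)

Lemma is_derive_response0 (R : realType) (alpha : R) (psi : R -> R) :
  sigmoidal psi -> is_derive (0 : R) (1 : R) (response alpha psi) 1.
Proof.
move=> sig; have := is_derive_response alpha (sigmoidal_is_derive0 sig).
by rewrite (sigmoidal0 sig) mulr0 mul0r mulr0 addr0.
Qed.

Lemma response0 (R : realType) (alpha : R) (psi : R -> R) :
  sigmoidal psi -> response alpha psi 0 = 0.
Proof. by move=> sig; rewrite /response (sigmoidal0 sig) expr0n mulr0 addr0. Qed.

Lemma gfun0 (R : realType) (alpha : R) (psi : R -> R) (p : R) :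
  sigmoidal psi -> gfun alpha psi 0 p = 0.
Proof. by move=> sig; rewrite /gfun (sigmoidal0 sig) expr0n/= mulr0; ring. Qed.

Lemma response_ratio (R : realType) (alpha : R) (psi : R -> R) (x p : R) :
  0 < p -> 0 < x ->
  ((1 + alpha) / p <= response alpha psi x / x) = (0 <= gfun alpha psi x p).
Proof.
move=> p0 x0; rewrite gfun_ratio ?gt_eqF// pmulr_rge0 ?subr_ge0//.
exact: mulr_gt0.
Qed.

Lemma response_ratio_zero (R : realType) (alpha : R) (psi : R -> R) (x p : R) :
  0 < p -> 0 < x -> gfun alpha psi x p = 0 ->
  response alpha psi x / x = (1 + alpha) / p.
Proof.
move=> p0 x0; rewrite gfun_ratio ?gt_eqF// => /eqP.
by rewrite mulf_eq0 gt_eqF ?mulr_gt0//= subr_eq0 => /eqP.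
Qed.

(** With two zeros, the ratio is [(1 + alpha) / p] at [x] and [y] and at least that at [e], so [x]
    would be a valley. *)
Lemma gfun_zero_right_uniq (R : realType) (alpha : R) (psi : R -> R)
    (p1 p e x y : R) :
  0 <= alpha -> sigmoidal psi ->
  (forall q, tangency_value alpha psi q -> q = p1) -> 0 < p -> p1 < p ->
  0 < e -> 0 <= gfun alpha psi e p -> e < x < y ->
  gfun alpha psi x p = 0 -> gfun alpha psi y p != 0.
Proof.
move=> al0 sig uniq p0 p1p e0 ge exy gx; apply/eqP => gy.
have [x0 y0] : 0 < x /\ 0 < y by lra.
apply: (no_valley al0 sig uniq p1p e0 exy).
- by rewrite gx.
- by rewrite (response_ratio_zero p0 x0 gx) response_ratio.
- by rewrite (response_ratio_zero p0 x0 gx) (response_ratio_zero p0 y0 gy).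
Qed.

(** Mirror case: now [y] would be the valley, between [x] and [e]. *)
Lemma gfun_zero_left_uniq (R : realType) (alpha : R) (psi : R -> R)
    (p1 p e x y : R) :
  0 <= alpha -> sigmoidal psi ->
  (forall q, tangency_value alpha psi q -> q = p1) -> 0 < p -> p1 < p ->
  0 <= gfun alpha psi e p -> 0 < x < y -> y < e ->
  gfun alpha psi x p = 0 -> gfun alpha psi y p != 0.
Proof.
move=> al0 sig uniq p0 p1p ge /andP[x0 xy] ye gx; apply/eqP => gy.
have [y0 e0] : 0 < y /\ 0 < e by lra.
apply: (@no_valley _ _ _ _ _ x y e al0 sig uniq p1p x0).
- exact/andP.
- by rewrite gy.
- by rewrite (response_ratio_zero p0 x0 gx) (response_ratio_zero p0 y0 gy).
- by rewrite (response_ratio_zero p0 y0 gy) response_ratio.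
Qed.

(* As x tends to 0+, response x / x tends to 1 >= (1 + alpha) / p, so a zero
   below e would be a valley of the ratio, or have one on its left. *)
Lemma gfun_no_zero_left (R : realType) (alpha : R) (psi : R -> R)
    (p1 p e x : R) :
  0 <= alpha -> sigmoidal psi ->
  (forall q, tangency_value alpha psi q -> q = p1) -> 0 < p -> p1 < p ->
  1 + alpha <= p -> 0 <= gfun alpha psi e p -> 0 < x < e ->
  gfun alpha psi x p != 0.
Proof.
move=> al0 sig uniq p0 p1p ap ge /andP[x0 xe]; apply/eqP => gx.
have e0 : 0 < e by lra.
have re : (1 + alpha) / p <= response alpha psi e / e by rewrite response_ratio.
have rx := response_ratio_zero p0 x0 gx.
have h0 : 0 < x / 2 by lra.
(* If g is nonnegative at [x / 2], the valley is [x]. Otherwise the ratio at [x / 2] is below 1, and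
   a point [a] closer to 0 has a larger ratio, so the valley is [x / 2]. *)
have [gh|gh] := leP 0 (gfun alpha psi (x / 2) p).
  apply: (@no_valley _ _ _ _ _ (x / 2) x e al0 sig uniq p1p h0).
  - by apply/andP; split; lra.
  - by rewrite gx.
  - by rewrite rx response_ratio.
  - by rewrite rx.
have rh : response alpha psi (x / 2) / (x / 2) < (1 + alpha) / p.
  by rewrite ltNge response_ratio// -ltNge.
have c1 : (1 + alpha) / p <= 1 by rewrite ler_pdivrMr// mul1r.
have [a [/andP[a0 ah] ra _]] := secant_near0 (is_derive_response0 alpha sig)
  (response0 alpha sig) (lt_le_trans rh c1) h0.
apply: (@no_valley _ _ _ _ _ a (x / 2) e al0 sig uniq p1p a0).
- by apply/andP; split; lra.
- exact: ltW.
- by rewrite ler_pdivlMr// ltW.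
- exact: le_trans (ltW rh) re.
Qed.

(** The slope [p - (1 + alpha)] at 0 is negative, so g(., p) dips below 0 just to the right of the
    origin before it is positive at [e]. *)
Lemma gfun_pos_zero_before (R : realType) (alpha : R) (psi : R -> R) (p e : R) :
  sigmoidal psi -> 0 < p < 1 + alpha -> 0 < e -> 0 < gfun alpha psi e p ->
  exists2 e1, 0 < e1 < e & gfun alpha psi e1 p = 0.
Proof.
move=> sig /andP[p0 pa] e0 ge.
have c1 : - ((1 + alpha) / p) < - 1 by rewrite ltrN2 ltr_pdivlMr// mul1r.
have [r [/andP[r0 re] + _]] := secant_near0
  (is_deriveN (is_derive_response0 alpha sig))
  ltac:(by rewrite fctE response0// oppr0) c1 e0.
rewrite fctE mulNr ltrN2 mulrAC ltr_pdivlMr// => gr.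
have {}gr : gfun alpha psi r p < 0.
  by rewrite /gfun -/(response alpha psi r); lra.
have [|c] := IVT (v := 0) (ltW re)
  (continuous_subspaceT (@continuous_gfun R alpha psi p sig)).
  by apply/andP; split; rewrite ?ge_min ?le_max ?(ltW gr) ?(ltW ge) ?orbT.
rewrite in_itv/= => /andP[rc ce] gc; exists c => //; apply/andP; split; first by lra.
by rewrite lt_neqAle ce andbT; apply/eqP => E; move: ge; rewrite -E gc ltxx.
Qed.

(** The slope at 0 is now positive, so g(., p) is negative just left of 0, while it is positive far
    to the left. *)
Lemma gfun_neg_zero (R : realType) (alpha : R) (psi : R -> R) (p : R) :
  0 <= alpha -> sigmoidal psi -> 1 + alpha < p ->
  exists2 e1, e1 < 0 & gfun alpha psi e1 p = 0.
Proof.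
move=> al0 sig ap; have p0 : 0 < p by lra.
have c1 : (1 + alpha) / p < 1 by rewrite ltr_pdivrMr// mul1r.
have [r [/andP[r0 _] _]] := secant_near0 (is_derive_response0 alpha sig)
  (response0 alpha sig) c1 ltr01.
rewrite mulrAC ltrNr ltr_pdivrMr// => gr.
have {}gr : gfun alpha psi (- r) p < 0.
  by rewrite /gfun -/(response alpha psi (- r)); lra.
have [e1 e1r ge1] := gfun_neg_zero_before al0 sig p0 gr.
by exists e1 => //; lra.
Qed.

(** * All zeros of g(., p), and the consensus equilibria they give *)

Lemma gfun_zeros (R : realType) (alpha : R) (psi : R -> R) (p1 p : R) :
  0 <= alpha -> sigmoidal psi -> tangency_value alpha psi p1 -> p1 < p ->
  exists e1 e2 : R,
    [/\ e1 < e2, gfun alpha psi e1 p = 0, gfun alpha psi e2 p = 0,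
        [/\ 0 < e2, p < 1 + alpha -> 0 < e1 & p != 1 + alpha -> e1 != 0]
      & (forall q, tangency_value alpha psi q -> q = p1) ->
        forall e, gfun alpha psi e p = 0 -> [\/ e = 0, e = e1 | e = e2]].
Proof.
move=> al0 sig [p10 [es [es0 ges1 _]]] p1p.
have p0 : 0 < p by lra.
have ges : 0 < gfun alpha psi es p by rewrite -ges1; exact: gfun_mono.
have [e2 ese2 ge2] := gfun_pos_zero_after al0 sig p0 ges.
have right_zero : (forall q, tangency_value alpha psi q -> q = p1) ->
    forall e, es <= e -> gfun alpha psi e p = 0 -> e = e2.
  move=> uniq e; rewrite le_eqVlt => /orP[/eqP <- g0|ese ge].
    by move: ges; rewrite g0 ltxx.
  have [lt|lt|//] := ltgtP e e2.
  - have := gfun_zero_right_uniq (y := e2) al0 sig uniq p0 p1p es0 (ltW ges).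
    by move=> /(_ e); rewrite ese lt ge2 eqxx => /(_ isT ge).
  - have := gfun_zero_right_uniq (y := e) al0 sig uniq p0 p1p es0 (ltW ges).
    by move=> /(_ e2); rewrite ese2 lt ge eqxx => /(_ isT ge2).
(* The cases follow the sign of the slope [p - (1 + alpha)] of g(., p) at 0. *)
have [pa|ap|pa] := ltgtP p (1 + alpha).
- have pap : 0 < p < 1 + alpha by apply/andP.
  have [e1 /andP[e10 e1s] ge1] := gfun_pos_zero_before sig pap es0 ges.
  exists e1, e2; split => //; first by lra.
    by split; [lra| |rewrite gt_eqF].
  move=> uniq e ge; have [e0|e0|e0] := ltgtP e 0.
  + have := @gfun_neg_no_zero R alpha psi p (- e) al0 sig.
    by rewrite opprK ge ltxx p0 (ltW pa) oppr_gt0 => /(_ isT e0).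
  + have [ees|ees] := ltP e es; last by constructor 3; exact: right_zero.
    constructor 2; have [lt|lt|//] := ltgtP e e1.
    * have := @gfun_zero_left_uniq _ _ _ _ _ _ e e1 al0 sig uniq p0 p1p (ltW ges).
      by rewrite e0 lt ge1 eqxx => /(_ isT e1s ge).
    * have := @gfun_zero_left_uniq _ _ _ _ _ _ e1 e al0 sig uniq p0 p1p (ltW ges).
      by rewrite e10 lt ge eqxx => /(_ isT ees ge1).
  + by constructor 1.
- have [e1 e10 ge1] := gfun_neg_zero al0 sig ap.
  exists e1, e2; split => //; first by lra.
    by split; [lra|lra|rewrite lt_eqF].
  move=> uniq e ge; have [e0|e0|e0] := ltgtP e 0.
  + constructor 2; have [lt|lt|//] := ltgtP e e1.
    * have := @gfun_neg_zero_uniq R alpha psi p (- e1) (- e) al0 sig p0.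
      by rewrite oppr_gt0 ltrN2 e10 lt !opprK ge eqxx => /(_ isT ge1).
    * have := @gfun_neg_zero_uniq R alpha psi p (- e) (- e1) al0 sig p0.
      by rewrite oppr_gt0 ltrN2 e0 lt !opprK ge1 eqxx => /(_ isT ge).
  + constructor 3; apply: right_zero => //; rewrite leNgt; apply/negP => ees.
    have := @gfun_no_zero_left _ _ _ _ _ _ e al0 sig uniq p0 p1p (ltW ap) (ltW ges).
    by rewrite e0 ees ge eqxx => /(_ isT).
  + by constructor 1.
(* In the borderline case [e1] is the origin itself, and both sign clauses on [e1] are vacuous. *)
- exists 0, e2; split => //; [by lra|exact: gfun0|by split; lra|].
  move=> uniq e ge; have [e0|e0|e0] := ltgtP e 0.
  + have := @gfun_neg_no_zero R alpha psi p (- e) al0 sig.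
    by rewrite opprK ge ltxx -pa p0 lexx oppr_gt0 => /(_ isT e0).
  + constructor 3; apply: right_zero => //; rewrite leNgt; apply/negP => ees.
    have := @gfun_no_zero_left _ _ _ _ _ _ e al0 sig uniq p0 p1p _ (ltW ges).
    by rewrite -pa lexx e0 ees ge eqxx => /(_ isT isT).
  + by constructor 1.
Qed.

Lemma gfun_zero_consensus (R : realType) (n : nat) (A2 : 'M[R]_n)
    (A3 : 'I_n -> 'M[R]_n) (psi : 'I_n -> R -> R) (psiu : R -> R)
    (alpha p e : R) :
  (forall i s, psi i s = psiu s) ->
  (forall i, \sum_j \sum_k A3 i j k = alpha * \sum_j A2 i j) ->
  gfun alpha psiu e p = 0 ->
  consensus_equilibrium (opinion_field A2 A3 psi p) (e *: ones R n).
Proof.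
move=> psi_eq A3_sum ge; split; last by apply/vlineP; exists e.
apply/colP => i; rewrite !mxE mulr1.
under eq_bigr do rewrite psi_eq !mxE mulr1.
(* At a consensus point the double sum is the total of the slice times [psiu e ^+ 2]; [A3_sum] then
   expresses it, and the degree, through the row sum of [A2]. *)
under [X in _ + p * X]eq_bigr => j _.
  under eq_bigr do rewrite !psi_eq !mxE mulr1 -mulrA.
  rewrite -mulr_suml; over.
rewrite -!mulr_suml /degree A3_sum.
transitivity ((\sum_j A2 i j) * gfun alpha psiu e p); last by rewrite ge mulr0.
by rewrite /gfun; ring.
Qed.

Unset Implicit Arguments.
Set Strict Implicit.

Theorem lemma2 (R : realType) (n : nat) (A2 : 'M[R]_n) (A3 : 'I_n -> 'M[R]_n)
    (psi : 'I_n -> R -> R) (psiu : R -> R) (alpha p1 : R)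
    (n_ge2 : (2 <= n)%N)
    (A2_ge0 : forall i j, 0 <= A2 i j)
    (A2_sym : A2^T = A2)
    (A2_irr : irreducible_mx A2)
    (A2_diag : forall i, A2 i i = 0)
    (A3_ge0 : forall i j k, 0 <= A3 i j k)
    (degree_gt0 : forall i, 0 < degree A2 A3 i)
    (psi_sigmoidal : forall i, sigmoidal (psi i))
    (psi_equal : forall i s, psi i s = psiu s)
    (A3_sym : forall i, A3 i = (A3 i)^T)
    (A3_zero : forall i j, A3 i i j = 0 /\ A3 i j i = 0)
    (A3_sum : forall i, \sum_j \sum_k A3 i j k = alpha * \sum_j A2 i j)
    (p1_tangency : tangency_value alpha psiu p1) :
  forall p : R, p1 < p ->
  exists e1 e2 : R,
    [/\ e1 < e2,
        gfun alpha psiu e1 p = 0 /\ gfun alpha psiu e2 p = 0,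
        consensus_equilibrium (opinion_field A2 A3 psi p) (e1 *: ones R n) /\
        consensus_equilibrium (opinion_field A2 A3 psi p) (e2 *: ones R n),
        [/\ 0 < e2, p < 1 + alpha -> 0 < e1 & p != 1 + alpha -> e1 != 0]
      & (forall q, tangency_value alpha psiu q -> q = p1) ->
        forall e, gfun alpha psiu e p = 0 -> [\/ e = 0, e = e1 | e = e2]].
Proof.
pose i0 : 'I_n := Ordinal (ltnW n_ge2).
have psiuE : psi i0 = psiu by apply/funext => s; exact: psi_equal.
have sig : sigmoidal psiu by rewrite -psiuE.
(* One row suffices: its degree is [1 + alpha] times the row sum of [A2], so that sum is nonzero,
   and [alpha] times it is a sum of nonnegative tensor entries. *)
have al0 : 0 <= alpha.
  have S0 : 0 <= \sum_j A2 i0 j by apply: sumr_ge0.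
  have : 0 < (1 + alpha) * \sum_j A2 i0 j.
    by have := degree_gt0 i0; rewrite /degree A3_sum mulrDl mul1r.
  have : 0 <= alpha * \sum_j A2 i0 j.
    by rewrite -A3_sum; apply: sumr_ge0 => j _; apply: sumr_ge0.
  have [->|Sn] := eqVneq (\sum_j A2 i0 j) 0; first by rewrite !mulr0 ltxx.
  by rewrite pmulr_lge0// lt_neqAle eq_sym Sn.
move=> p p1p.
have [e1 [e2 [lt12 ge1 ge2 signs zeros]]] := gfun_zeros al0 sig p1_tangency p1p.
exists e1, e2; split => //.
by split; apply: gfun_zero_consensus psi_equal A3_sum _.
Qed.
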